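(* Let $(\Omega,2^\Omega,\mu)$ be a finite probability space and let $(P_t)_{t\ge0}$ be a symmetric Markov semigroup on $L^2(\Omega,\mu)$ with generator $L$. Assume that there is a constant $C>0$ such that $\mathbb{E}f^2-(\mathbb{E}f)^2\le C\cdot\mathbb{E}[fLf]$ for every $f\colon\Omega\to\mathbb{R}$. Then for every $p\in(1,\infty)$, every $f\colon\Omega\to\mathbb{R}$ with $\mathbb{E}f=0$, and every $t>0$, $$\|P_tf\|_p\le\exp\left(-\frac{(2p-2)t}{(p^2-2p+2)C}\right)\cdot\|f\|_p .$$
   Context: $\mathbb{E}$ denotes expectation with respect to $\mu$ and $\|f\|_p=(\mathbb{E}|f|^p)^{1/p}$. A symmetric Markov semigroup is a (continuous in $t$) family of linear operators with $P_0=\mathrm{Id}$, $P_{s+t}=P_sP_t$, each $P_t$ positivity preserving, $P_t\mathbf{1}=\mathbf{1}$, and self-adjoint on $L^2(\Omega,\mu)$ (so $\mu$ is invariant). Its generator is $L=-\frac{\mathrm d}{\mathrm dt}P_t\big|_{t=0^+}$. *)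

(* Defs.v *)
From HB Require Import structures.
From mathcomp Require Import all_boot all_order all_algebra.
From mathcomp Require Import all_classical all_reals all_analysis.

Set Implicit Arguments.
Unset Strict Implicit.
Unset Printing Implicit Defensive.

Import Order.TTheory GRing.Theory Num.Theory.
Import numFieldNormedType.Exports.

Local Open Scope classical_set_scope.
Local Open Scope ring_scope.

Section FiniteProbabilitySpace.
Context {R : realType} {Omega : finType}.
Implicit Types (mu f g : Omega -> R) (T L : (Omega -> R) -> Omega -> R).

(* [mu x] is the mass of the atom [x]; atoms of mass zero are allowed. *)
Definition is_probability mu : Prop :=
  (forall x, 0 <= mu x) /\ \sum_x mu x = 1.

Definition expect mu f : R := \sum_x mu x * f x.

Definition Lp_norm mu (p : R) f : R :=
  (expect mu (fun x => `|f x| `^ p)) `^ p^-1.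

Definition as_eq mu f g : Prop := forall x, 0 < mu x -> f x = g x.

Definition as_nonneg mu f : Prop := forall x, 0 < mu x -> 0 <= f x.

(* An element of L^2(Omega, mu) is an almost-sure class of functions, handled
   here through representatives: an operator must respect almost-sure equality,
   and identities between operators are required only almost surely. *)
Record L2_linear mu T : Prop := {
  L2_linear_as_eq : forall f g, as_eq mu f g -> as_eq mu (T f) (T g);
  L2_linearP : forall (a : R) f g,
    as_eq mu (T (fun x => a * f x + g x)) (fun x => a * T f x + T g x)
}.

(* The time parameter ranges over R; only the values at [0 <= t] matter. *)
Record symmetric_Markov_semigroup mu (P : R -> (Omega -> R) -> Omega -> R)
  : Prop := {
  semigroup_linear : forall t, 0 <= t -> L2_linear mu (P t);
  semigroup0 : forall f, as_eq mu (P 0 f) f;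
  semigroupD : forall s t f, 0 <= s -> 0 <= t ->
    as_eq mu (P (s + t) f) (P s (P t f));
  semigroup_continuous : forall f t, 0 <= t ->
    Lp_norm mu 2 (fun x => P s f x - P t f x)
      @[s --> within `[0, +oo[ (nbhs t)] --> (0 : R);
  semigroup_nonneg : forall t f, 0 <= t ->
    as_nonneg mu f -> as_nonneg mu (P t f);
  semigroup_unit : forall t, 0 <= t -> as_eq mu (P t (fun=> 1)) (fun=> 1);
  semigroup_selfadjoint : forall t f g, 0 <= t ->
    expect mu (fun x => f x * P t g x) = expect mu (fun x => P t f x * g x)
}.

(* [L f] is minus the right derivative of [t |-> P t f] at 0, taken in L^2. *)
Definition is_generator mu (P : R -> (Omega -> R) -> Omega -> R) L : Prop :=
  forall f, Lp_norm mu 2 (fun x => t^-1 * (P t f x - P 0 f x) - (- L f x))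
    @[t --> 0^'+] --> (0 : R).

End FiniteProbabilitySpace.

(* Main.v *)
(* The decay follows by Gronwall from E[phi(f) L f] >= rate * E|f|^p for mean-zero
   f, where phi(x) = sgn(x) |x|^(p-1). Put h = p/2, theta = (h-1)/h and
   g(x) = sgn(x) |x|^h. The bound splits into two parts.
   (1) Stroock-Varopoulos: E[phi(f) L f] >= (1 - theta^2) E[g(f) L g(f)], and the
   right-hand side is at least (1 - theta^2) Var(g(f)) / C by Poincare.
   (2) If E f = 0 then (E g(f))^2 <= theta^2 Var(g(f)), that is,
   Var(g(f)) >= E|f|^p / (1 + theta^2): sum a two-point inequality over the pairs
   (x, y) with f(x) > 0 > f(y), weighted by mu(x) mu(y), and use Cauchy-Schwarz.
   The rate is (1 - theta^2) / ((1 + theta^2) C). In logarithmic coordinates both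
   two-point inequalities reduce to |sinh(theta x)| <= |theta sinh x|. *)
Require Import Defs.
From HB Require Import structures.
From mathcomp Require Import all_boot all_order all_algebra.
From mathcomp Require Import all_classical all_reals all_analysis.
From mathcomp Require Import ring lra.

Set Implicit Arguments.
Unset Strict Implicit.
Unset Printing Implicit Defensive.

Import Order.TTheory GRing.Theory Num.Theory.
Import numFieldNormedType.Exports.

Local Open Scope classical_set_scope.
Local Open Scope ring_scope.

(** * Hyperbolic sines and differences of powers *)

Section RealInequalities.
Context {R : realType}.
Implicit Types (a b c h p s t u v x y theta : R).

(** The difference [D] of the two sides vanishes at [0], and its derivative is nonnegative because
    cosh increases on the half-line. *)
Lemma sinh_scaled_le theta x : 0 <= theta <= 1 -> 0 <= x ->
  expR (theta * x) - expR (- (theta * x)) <= theta * (expR x - expR (- x)).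
Proof.
move=> /andP[theta_ge0 theta_le1] x_ge0.
pose D y : R := theta * (expR y - expR (- y))
  - (expR (theta * y) - expR (- (theta * y))).
have dD y : is_derive y 1 D (theta * (expR y + expR (- y))
    - theta * (expR (theta * y) + expR (- (theta * y)))).
  by rewrite /D; apply: is_derive_eq; rewrite /GRing.scale /=; ring.
suff : D 0 <= D x.
  by rewrite /D mulr0 oppr0 subrr mulr0 subr0 subr_ge0.
apply: (@ger0_derive1_ndecry _ D 0) => // [{}y|].
- rewrite in_itv/= andbT => y_gt0.
  rewrite derive1E derive_val -mulrBr mulr_ge0// !expRN subr_ge0.
  set E := expR (theta * y); set F := expR y.
  have E_gt0 : 0 < E by exact: expR_gt0.
  have E_ge1 : 1 <= E by rewrite -expR0 ler_expR mulr_ge0// ltW.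
  have EF : E <= F by rewrite ler_expR ler_piMl// ltW.
  have F_gt0 : 0 < F by exact: expR_gt0.
  (* This is the growth of cosh: both factors are nonnegative when [1 <= E <= F]. *)
  have -> : F + F^-1 = E + E^-1 + (F - E) * (1 - (E * F)^-1).
    by field; rewrite !gt_eqF.
  rewrite lerDl mulr_ge0 ?subr_ge0// invf_le1 ?mulr_gt0//.
  by rewrite -[1]mulr1 ler_pM// (le_trans E_ge1).
- apply: continuous_subspaceT => z; apply: differentiable_continuous;
  by apply/derivable1_diffP; have [] := dD z.
Qed.

(** Since sinh is odd, squaring reduces to [|theta|] and [|x|]. Negative [theta] occurs below when
    [h < 1], that is, [p < 2]. *)
Lemma sqr_sinh_scaled_le theta x : `|theta| <= 1 ->
  (expR (theta * x) - expR (- (theta * x))) ^+ 2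
    <= theta ^+ 2 * (expR x - expR (- x)) ^+ 2.
Proof.
move=> theta_le1.
have abs y : (expR y - expR (- y)) ^+ 2 = (expR `|y| - expR (- `|y|)) ^+ 2.
  by case: (ger0P y) => // _; rewrite opprK -sqrrN opprB.
rewrite abs (abs x) normrM -[theta ^+ 2]real_normK ?num_real// -exprMn.
have le1 : 0 <= `|theta| <= 1 by rewrite normr_ge0.
rewrite ler_sqr ?sinh_scaled_le//.
- by rewrite nnegrE subr_ge0 ler_expR (@le_trans _ _ 0) ?oppr_le0 ?mulr_ge0.
- by rewrite nnegrE mulr_ge0// subr_ge0 ler_expR (@le_trans _ _ 0) ?oppr_le0.
Qed.

(* With [u = e^a] and [v = e^b] this is the inequality between hyperbolic sines
   at [x = h (a - b) / 2] and [theta = (h - 1) / h]. *)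
Lemma sqr_powRB_le h u v : 2^-1 <= h -> 0 < u -> 0 < v ->
  h ^+ 2 * (u * v * (u `^ (h - 1) - v `^ (h - 1)) ^+ 2)
    <= (h - 1) ^+ 2 * (u `^ h - v `^ h) ^+ 2.
Proof.
move=> h_ge u_gt0 v_gt0.
have h_gt0 : 0 < h by apply: lt_le_trans h_ge; rewrite invr_gt0.
have [a <-] := expR_total u_gt0; have [b <-] := expR_total v_gt0.
rewrite -!expRM.
pose x := h * (a - b) / 2; pose theta := (h - 1) / h.
have hsum c : expR (a * c) - expR (b * c)
    = expR (c * (a + b) / 2) * (expR (c * (a - b) / 2) - expR (- (c * (a - b) / 2))).
  by rewrite mulrBr -!expRD; congr (expR _ - expR _); field.
rewrite !hsum.
(* The weight [u * v] makes the prefactors of both sides equal, so that only hyperbolic sines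
   remain. *)
have factor : expR a * expR b * expR ((h - 1) * (a + b) / 2) ^+ 2
    = expR (h * (a + b) / 2) ^+ 2.
  by rewrite -!expRM_natl -!expRD; congr expR; field.
rewrite !exprMn (mulrA (expR a * _)) factor.
have -> : (h - 1) * (a - b) / 2 = theta * x by rewrite /theta /x; field; rewrite gt_eqF.
have -> : h - 1 = h * theta by rewrite /theta; field; rewrite gt_eqF.
rewrite [leRHS]mulrCA [leLHS]mulrCA; apply: ler_wpM2l; first exact: sqr_ge0.
rewrite exprMn -[leRHS]mulrA; apply: ler_wpM2l; first exact: sqr_ge0.
apply: sqr_sinh_scaled_le.
(* [|theta| <= 1] amounts to [2^-1 <= h]. *)
by rewrite ler_norml /theta ler_pdivlMr// ler_pdivrMr//; lra.
Qed.

End RealInequalities.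

(* [sgn x * |x| ^ a] for [a <> 0], since then [0 `^ a = 0]. The
   positive and negative parts are kept separate for [sqr_expect_spow_le]. *)
Definition spow {R : realType} (a x : R) : R :=
  Num.max x 0 `^ a - Num.max (- x) 0 `^ a.

(** * Signed powers and their two-point inequalities *)

Section SignedPowers.
Context {R : realType}.
Implicit Types (a b h p u v x y : R).

Lemma spow_ge0E a x : a != 0 -> 0 <= x -> spow a x = x `^ a.
Proof.
move=> a_neq0 x_ge0; rewrite /spow (max_idPl x_ge0).
by rewrite (max_idPr _) ?oppr_le0// powR0// subr0.
Qed.

Lemma spowN a x : spow a (- x) = - spow a x.
Proof. by rewrite /spow opprK opprB. Qed.

Lemma normr_spow a x : a != 0 -> `|spow a x| = `|x| `^ a.
Proof.
move=> a_neq0; case: (ger0P x) => x0.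
  by rewrite spow_ge0E// ger0_norm ?powR_ge0.
by rewrite -normrN -spowN spow_ge0E ?ger0_norm ?powR_ge0 ?oppr_ge0 ?ltW.
Qed.

Lemma mulr_spow p x : 1 < p -> x * spow (p - 1) x = `|x| `^ p.
Proof.
move=> p_gt1; have p1_neq0 : p - 1 != 0 by rewrite subr_eq0 gt_eqF.
wlog x_ge0 : x / 0 <= x => [wlogx|].
  case: (lerP 0 x) => [/wlogx//|x_lt0].
  by rewrite -normrN -wlogx ?oppr_ge0 ?ltW// spowN mulrNN.
by rewrite spow_ge0E// ger0_norm// mulr_powRB1// (lt_trans ltr01).
Qed.

Lemma sqr_powR h u : 0 < h -> u `^ h ^+ 2 = u `^ (2 * h).
Proof.
move=> h_gt0; rewrite expr2 -powRD; first by congr (_ `^ _); ring.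
by apply/implyP; rewrite paddr_eq0 ?ltW// gt_eqF.
Qed.

Lemma sqr_spow h x : 0 < h -> spow h x ^+ 2 = `|x| `^ (2 * h).
Proof.
by move=> h_gt0; rewrite -real_normK ?num_real// normr_spow ?gt_eqF// sqr_powR.
Qed.

(** At a zero of [f] the power need not be differentiable, so the tolerance e^(1/a) on [f] is used
    directly; elsewhere the power is differentiable. *)
Lemma continuous_powR_ge0 a (f : R -> R) :
  0 < a -> (forall x, 0 <= f x) -> continuous f ->
  continuous (fun x => f x `^ a).
Proof.
move=> a_gt0 f_ge0 fc x; have := f_ge0 x; rewrite le_eqVlt => /predU1P[fx0|fx_gt0].
  apply/cvgrPdist_lt => e e_gt0; rewrite -fx0 powR0 ?gt_eqF//.
  have d_gt0 : 0 < e `^ a^-1 by rewrite powR_gt0.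
  have /cvgrPdist_lt/(_ _ d_gt0) := fc x; rewrite -fx0.
  apply: filterS => y; rewrite !sub0r !normrN !ger0_norm ?powR_ge0// => fy.
  rewrite -[e]powRr1 ?ltW// -(mulVf (lt0r_neq0 a_gt0)) powRrM.
  by apply: gt0_ltr_powR; rewrite ?nnegrE ?powR_ge0.
apply: (@cvg_comp _ _ _ f (fun y => y `^ a) _ _ _ (fc x)).
have : {for f x, continuous (fun y : R => y `^ a)}; last exact.
apply: differentiable_continuous; apply/derivable1_diffP.
by apply: derivable_powR; rewrite in_itv/= andbT.
Qed.

Lemma continuous_spow a : 0 < a -> continuous (spow a : R -> R).
Proof.
move=> a_gt0 x; apply: cvgB.
- apply: (@continuous_powR_ge0 _ (fun y => Num.max y 0)) => // y.
    by rewrite le_max lexx orbT.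
  by apply: continuous_max => //; exact: cvg_cst.
- apply: (@continuous_powR_ge0 _ (fun y => Num.max (- y) 0)) => // y.
    by rewrite le_max lexx orbT.
  by apply: continuous_max; [exact: opp_continuous|exact: cvg_cst].
Qed.

Lemma continuous_normr_powR a : 0 < a -> continuous (fun x : R => `|x| `^ a).
Proof.
by move=> a_gt0; apply: continuous_powR_ge0 => //; exact: norm_continuous.
Qed.

Lemma powR_split h u : 0 < u -> u `^ h = u * u `^ (h - 1).
Proof.
move=> u_gt0; rewrite powRB ?(gt_eqF u_gt0) ?implybT//.
by rewrite powRr1 ?ltW// mulrC divfK ?gt_eqF.
Qed.

(* Stroock-Varopoulos inequality with [p = 2 h]. *)
Lemma spow_StroockVaropoulos h x y : 2^-1 < h ->
  (2 * h - 1) * (spow h x - spow h y) ^+ 2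
    <= h ^+ 2 * ((x - y) * (spow (2 * h - 1) x - spow (2 * h - 1) y)).
Proof.
move=> h_gt; have h_gt0 : 0 < h by lra.
have q_gt0 : 0 < 2 * h - 1 by lra.
(* As 2h - 1 = 1 + 2(h - 1), everything becomes polynomial in [u], [v], A = u^(h-1) and B =
   v^(h-1). *)
have qE u : 0 < u -> u `^ (2 * h - 1) = u * u `^ (h - 1) ^+ 2.
  move=> u_gt0; rewrite expr2 -powRD ?(gt_eqF u_gt0) ?implybT//.
  by rewrite powR_split//; congr (_ * _ `^ _); ring.
(* Equal signs: for positive [u] and [v], right minus left is (h-1)^2 (uA - vB)^2 - h^2 uv (A -
   B)^2, nonnegative by [sqr_powRB_le]. *)
have same u v : 0 <= u -> 0 <= v -> (2 * h - 1) * (u `^ h - v `^ h) ^+ 2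
    <= h ^+ 2 * ((u - v) * (u `^ (2 * h - 1) - v `^ (2 * h - 1))).
  have zero w : 0 <= w -> (2 * h - 1) * (w `^ h) ^+ 2 <= h ^+ 2 * (w * w `^ (2 * h - 1)).
    move=> w_ge0; rewrite mulr_powRB1 ?mulr_gt0// sqr_powR//.
    apply: ler_wpM2r; first exact: powR_ge0.
    by have := sqr_ge0 (h - 1); lra.
  rewrite le_eqVlt => /predU1P[<-|u_gt0].
    move=> v_ge0; rewrite !powR0 ?gt_eqF// !sub0r sqrrN mulrNN; exact: zero.
  rewrite le_eqVlt => /predU1P[<-|v_gt0].
    by rewrite !powR0 ?gt_eqF// !subr0; apply: zero; rewrite ltW.
  have := sqr_powRB_le (ltW h_gt) u_gt0 v_gt0.
  by rewrite !qE// !(powR_split h)//; lra.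
(* Opposite signs: 2h - 1 <= h^2 and (u+v)(uA^2 + vB^2) - (uA + vB)^2 = uv (A - B)^2. *)
have opposite u v : 0 <= u -> 0 <= v -> (2 * h - 1) * (u `^ h + v `^ h) ^+ 2
    <= h ^+ 2 * ((u + v) * (u `^ (2 * h - 1) + v `^ (2 * h - 1))).
  move=> u_ge0 v_ge0.
  apply: (@le_trans _ _ (h ^+ 2 * (u `^ h + v `^ h) ^+ 2)).
    by apply: ler_wpM2r; [exact: sqr_ge0|have := sqr_ge0 (h - 1); lra].
  apply: ler_wpM2l; first exact: sqr_ge0.
  move: u_ge0; rewrite le_eqVlt => /predU1P[<-|u_gt0].
    by rewrite !powR0 ?gt_eqF// !add0r mulr_powRB1 ?mulr_gt0// sqr_powR.
  move: v_ge0; rewrite le_eqVlt => /predU1P[<-|v_gt0].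
    by rewrite !powR0 ?gt_eqF// !addr0 mulr_powRB1 ?mulr_gt0// ?sqr_powR// ltW.
  rewrite !qE// !(powR_split h)// -subr_ge0.
  rewrite (_ : _ - _ = u * v * (u `^ (h - 1) - v `^ (h - 1)) ^+ 2); last by ring.
  by rewrite mulr_ge0 ?sqr_ge0// mulr_ge0 ?ltW.
have h0 : h != 0 by rewrite gt_eqF.
have q0 : 2 * h - 1 != 0 by rewrite gt_eqF.
case: (lerP 0 x) => x0; case: (lerP 0 y) => y0.
- by rewrite !spow_ge0E//; exact: same.
- have := @opposite x (- y) x0; rewrite -!spow_ge0E ?oppr_ge0 ?(ltW y0)//.
  by rewrite !spowN; apply.
- have := @opposite (- x) y; rewrite -!spow_ge0E ?oppr_ge0 ?(ltW x0)//.
  by rewrite !spowN => /(_ isT y0); lra.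
- have := @same (- x) (- y); rewrite -!spow_ge0E ?oppr_ge0 ?(ltW x0) ?(ltW y0)//.
  by rewrite !spowN => /(_ isT isT); lra.
Qed.

(** The two-point inequality for values [u] and [-v]. For positive [u] and [v] it reduces to h^2 uv
    (A - B)^2 <= (h-1)^2 (uA + vB)^2 with A = u^(h-1) and B = v^(h-1), which is weaker than
    [sqr_powRB_le]. The indicators later sum to the probability that [f] is nonzero. *)
Lemma powR_cross_le h (u v : R) : 2^-1 < h -> 0 <= u -> 0 <= v ->
  (h ^+ 2 + (h - 1) ^+ 2) * (v * u `^ h - u * v `^ h) ^+ 2
    <= (h - 1) ^+ 2 * ((u * (0 < v)%R%:R + v * (0 < u)%R%:R)
                        * (v * u `^ (2 * h) + u * v `^ (2 * h))).
Proof.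
move=> h_gt; have h_gt0 : 0 < h by lra.
have h0 : h != 0 by rewrite gt_eqF.
rewrite le_eqVlt => /predU1P[<- v_ge0|u_gt0].
  by rewrite !powR0 ?mulf_neq0// ltxx !(mul0r, mulr0, addr0, subr0, expr0n).
rewrite le_eqVlt => /predU1P[<-|v_gt0].
  by rewrite !powR0 ?mulf_neq0// ltxx !(mul0r, mulr0, addr0, subr0, expr0n).
rewrite u_gt0 v_gt0 !mulr1 -!sqr_powR//.
have := sqr_powRB_le (ltW h_gt) u_gt0 v_gt0.
rewrite !(powR_split h)//.
set A := u `^ (h - 1); set B := v `^ (h - 1) => K.
have A_gt0 : 0 < A by exact: powR_gt0.
have B_gt0 : 0 < B by exact: powR_gt0.
have {K} : h ^+ 2 * (u * v * (A - B) ^+ 2) <= (h - 1) ^+ 2 * (u * A + v * B) ^+ 2.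
  apply: (le_trans K); apply: ler_wpM2l; first exact: sqr_ge0.
  rewrite -subr_ge0 (_ : _ - _ = 4 * (u * A * (v * B))); last by ring.
  by rewrite !mulr_ge0// ltW.
move/(ler_wpM2l (mulr_ge0 (ltW u_gt0) (ltW v_gt0))).
by lra.
Qed.

(** By convexity |x|^p lies above its tangent at [y]; Young's inequality with exponents p and
    p/(p-1) bounds the mixed term. *)
Lemma powR_tangent_le p x y : 1 < p ->
  `|y| `^ p + p * (spow (p - 1) y * (x - y)) <= `|x| `^ p.
Proof.
move=> p_gt1; have p_gt0 : 0 < p by lra.
have q_gt0 : 0 < p - 1 by lra.
rewrite mulrBr (mulrC _ y) mulr_spow//.
have young : p * (spow (p - 1) y * x) <= `|x| `^ p + (p - 1) * `|y| `^ p.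
  have conj : p^-1 + (p / (p - 1))^-1 = 1 by field; rewrite !gt_eqF.
  have := @conjugate_powR R `|x| (`|y| `^ (p - 1)) p (p / (p - 1)) (normr_ge0 _)
    (powR_ge0 _ _) p_gt0 (divr_gt0 p_gt0 q_gt0) conj.
  rewrite -powRrM mulrC [_ * (p / _)](_ : _ = p); last by field; rewrite gt_eqF.
  rewrite invf_div -(ler_pM2l p_gt0).
  rewrite (_ : p * (_ + _) = `|x| `^ p + (p - 1) * `|y| `^ p); last first.
    by field; rewrite gt_eqF.
  apply: le_trans; rewrite ler_pM2l// -normr_spow ?gt_eqF// -normrM.
  exact: ler_norm.
by lra.
Qed.

End SignedPowers.

(** * A Cauchy-Schwarz inequality for finite sums *)

Section FiniteSums.
Context {R : realType}.

Lemma sum_pairM (I J : finType) (a : I -> R) (b : J -> R) :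
  \sum_(q : I * J) a q.1 * b q.2 = (\sum_i a i) * (\sum_j b j).
Proof.
rewrite -(pair_bigA _ (fun i j => a i * b j)) /= mulr_suml.
by apply: eq_bigr => i _; rewrite mulr_sumr.
Qed.

(** Both sides expand into symmetrized double sums, compared termwise: the square of 2 K A_i A_j is
    at most 4 (B_i D_i)(B_j D_j), hence at most (B_i D_j + B_j D_i)^2 by AM-GM. *)
Lemma sum_CauchySchwarz (I : finType) (K : R) (m A B D : I -> R) :
  0 <= K -> (forall i, 0 <= m i) -> (forall i, 0 <= B i) ->
  (forall i, 0 <= D i) -> (forall i, K * A i ^+ 2 <= B i * D i) ->
  K * (\sum_i m i * A i) ^+ 2
    <= (\sum_i m i * B i) * (\sum_i m i * D i).
Proof.
move=> K_ge0 m_ge0 B_ge0 D_ge0 ABD.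
have cross i j : 2 * K * (A i * A j) <= B i * D j + B j * D i.
  apply: (@le_trans _ _ `|2 * K * (A i * A j)|); first exact: ler_norm.
  have BD_ge0 : 0 <= B i * D j + B j * D i by rewrite addr_ge0 ?mulr_ge0.
  rewrite -(ler_sqr (normr_ge0 _) BD_ge0) real_normK ?num_real//.
  apply: (@le_trans _ _ (4 * ((B i * D i) * (B j * D j)))).
    rewrite (_ : _ ^+ 2 = 4 * ((K * A i ^+ 2) * (K * A j ^+ 2))); last by ring.
    by rewrite ler_pM2l// ler_pM// mulr_ge0 ?sqr_ge0.
  rewrite -subr_ge0 (_ : _ - _ = (B i * D j - B j * D i) ^+ 2) ?sqr_ge0//.
  by ring.
rewrite -(@ler_pM2l _ 2)// mulrA expr2 -!sum_pairM 2!mulr_sumr.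
rewrite (_ : \sum_q 2 * _ = \sum_(q : I * I) (m q.1 * m q.2) *
    (B q.1 * D q.2 + B q.2 * D q.1)); last first.
  have swap : \sum_(q : I * I) m q.1 * m q.2 * (B q.2 * D q.1)
            = \sum_(q : I * I) m q.1 * m q.2 * (B q.1 * D q.2).
    rewrite (reindex_inj (h := fun q : I * I => (q.2, q.1))) /=.
      by apply: eq_bigr => q _; ring.
    by move=> [i1 i2] [j1 j2] [-> ->].
  under [in RHS]eq_bigr do rewrite mulrDr.
  rewrite big_split/= swap -big_split/=.
  by apply: eq_bigr => q _; ring.
apply: ler_sum => q _; rewrite [leLHS](_ : _ = m q.1 * m q.2 *
    (2 * K * (A q.1 * A q.2))); last by ring.
by apply: ler_wpM2l => //; rewrite mulr_ge0.
Qed.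

End FiniteSums.

(** * Expectations, and signed powers of mean-zero functions *)

Section MeanZero.
Context {R : realType} {Omega : finType}.
Variable mu : Omega -> R.
Hypothesis mu_prob : is_probability mu.
Implicit Types (f g : Omega -> R).

Lemma eq_expect f g : as_eq mu f g -> expect mu f = expect mu g.
Proof.
move=> fg; apply: eq_bigr => x _.
have : 0 <= mu x by have [] := mu_prob.
by rewrite le_eqVlt => /predU1P[<-|/fg ->//]; rewrite !mul0r.
Qed.

Lemma expect_ge0 f : (forall x, 0 <= f x) -> 0 <= expect mu f.
Proof. by move=> f_ge0; apply: sumr_ge0 => x _; rewrite mulr_ge0//; case: mu_prob. Qed.

Lemma ler_expect f g : (forall x, f x <= g x) -> expect mu f <= expect mu g.
Proof. by move=> fg; apply: ler_sum => x _; rewrite ler_wpM2l//; case: mu_prob. Qed.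

Lemma expectD f g : expect mu (fun x => f x + g x) = expect mu f + expect mu g.
Proof. by rewrite -big_split; apply: eq_bigr => x _; rewrite mulrDr. Qed.

Lemma expectZ a f : expect mu (fun x => a * f x) = a * expect mu f.
Proof. by rewrite /expect mulr_sumr; apply: eq_bigr => x _; rewrite mulrCA. Qed.

(** This is (1 + theta^2) (E g(f))^2 <= theta^2 E|f|^p, times h^2. Mean zero gives both parts [u]
    and [v] the same expectation [I], so the cross terms of [powR_cross_le] sum over all pairs to
    [I * G]. *)
Lemma sqr_expect_spow_le h f : 2^-1 < h -> expect mu f = 0 ->
  (h ^+ 2 + (h - 1) ^+ 2) * expect mu (fun x => spow h (f x)) ^+ 2
    <= (h - 1) ^+ 2 * expect mu (fun x => `|f x| `^ (2 * h)).
Proof.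
move=> h_gt Ef0; have h_gt0 : 0 < h by lra.
have [mu_ge0 mu1] := mu_prob.
pose u x := Num.max (f x) 0; pose v x : R := Num.max (- f x) 0.
have u_ge0 x : 0 <= u x by rewrite le_max lexx orbT.
have v_ge0 x : 0 <= v x by rewrite le_max lexx orbT.
have uv x : f x = u x - v x.
  rewrite /u /v; case: (lerP 0 (f x)) => f0.
    by rewrite (max_idPr _) ?oppr_le0// subr0.
  by rewrite (max_idPl _) ?oppr_ge0 ?ltW// opprK add0r.
have norm_uv x : `|f x| `^ (2 * h) = u x `^ (2 * h) + v x `^ (2 * h).
  have h2_neq0 : 2 * h != 0 by rewrite mulf_neq0// gt_eqF.
  rewrite /u /v; case: (lerP 0 (f x)) => f0.
    by rewrite (max_idPr _) ?oppr_le0// powR0// addr0 ger0_norm.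
  by rewrite (max_idPl _) ?oppr_ge0 ?ltW// powR0// add0r ltr0_norm.
have Euv : expect mu u = expect mu v.
  apply/eqP; rewrite -subr_eq0 -Ef0 /expect -sumrB; apply/eqP.
  by apply: eq_bigr => x _; rewrite uv mulrBr.
set I := expect mu u.
set N := expect mu (fun x => `|f x| `^ (2 * h)).
set G := expect mu (fun x => spow h (f x)).
(* The probability that [f] is nonzero; the two events are disjoint, so it is at most 1. *)
pose sgnP := expect mu (fun x => (0 < u x)%R%:R) + expect mu (fun x => (0 < v x)%R%:R).
have sgnP_le1 : sgnP <= 1.
  rewrite /sgnP -expectD -[leRHS]mu1; apply: ler_sum => x _.
  rewrite -[leRHS]mulr1; apply: ler_wpM2l => //.
  rewrite /u /v; case: (lerP 0 (f x)) => f0.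
    by rewrite (max_idPr _) ?oppr_le0// ltxx addr0; case: (_ < _); rewrite ?lexx ?ler01.
  by rewrite ltxx add0r; case: (_ < _); rewrite ?lexx ?ler01.
have N_ge0 : 0 <= N by apply: expect_ge0 => x; exact: powR_ge0.
have I_ge0 : 0 <= I by exact: expect_ge0.
have : (h ^+ 2 + (h - 1) ^+ 2) * (I * G) ^+ 2
    <= ((h - 1) ^+ 2 * (I * sgnP)) * (I * N).
  pose m (q : Omega * Omega) := mu q.1 * mu q.2.
  have msum (a b : Omega -> R) :
      \sum_q m q * (a q.1 * b q.2) = expect mu a * expect mu b.
    by rewrite /expect -sum_pairM; apply: eq_bigr => q _; rewrite /m mulrACA.
  have := @sum_CauchySchwarz R _ (h ^+ 2 + (h - 1) ^+ 2) m
    (fun q => v q.2 * u q.1 `^ h - u q.1 * v q.2 `^ h)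
    (fun q => (h - 1) ^+ 2 * (u q.1 * (0 < v q.2)%R%:R + v q.2 * (0 < u q.1)%R%:R))
    (fun q => v q.2 * u q.1 `^ (2 * h) + u q.1 * v q.2 `^ (2 * h)).
  have -> : \sum_q m q * (v q.2 * u q.1 `^ h - u q.1 * v q.2 `^ h) = I * G.
    under eq_bigr do rewrite mulrBr (mulrC (v _)).
    rewrite sumrB (msum (fun x => u x `^ h) v) (msum u (fun x => v x `^ h)).
    rewrite -Euv (mulrC _ (expect mu u)) -mulrBr; congr (_ * _).
    by rewrite /G /expect -sumrB; apply: eq_bigr => x _; rewrite -mulrBr.
  have -> : \sum_q m q * ((h - 1) ^+ 2 *
      (u q.1 * (0 < v q.2)%R%:R + v q.2 * (0 < u q.1)%R%:R))
      = (h - 1) ^+ 2 * (I * sgnP).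
    under eq_bigr do rewrite mulrCA mulrDr (mulrC (v _)).
    rewrite -mulr_sumr big_split/= (msum u (fun y => (0 < v y)%R%:R)).
    rewrite (msum (fun x => (0 < u x)%R%:R) v) -Euv /sgnP -/I.
    by congr (_ * _); ring.
  have -> : \sum_q m q * (v q.2 * u q.1 `^ (2 * h) + u q.1 * v q.2 `^ (2 * h))
      = I * N.
    under eq_bigr do rewrite mulrDr (mulrC (v _)).
    rewrite big_split/= (msum (fun x => u x `^ (2 * h)) v).
    rewrite (msum u (fun x => v x `^ (2 * h))) -Euv (mulrC _ (expect mu u)).
    rewrite -mulrDr -expectD; congr (_ * _).
    by apply: eq_bigr => x _; rewrite norm_uv.
  apply.
  - by rewrite addr_ge0 ?sqr_ge0.
  - by move=> q; rewrite mulr_ge0.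
  - by move=> q; rewrite mulr_ge0 ?sqr_ge0// addr_ge0 ?mulr_ge0 ?ler0n.
  - by move=> q; rewrite addr_ge0 ?mulr_ge0 ?powR_ge0.
  - by move=> q; rewrite -mulrA; exact: powR_cross_le.
(* [I ^+ 2] cancels unless [I = 0]; in that case [u] and [v] vanish on every atom of positive mass
   and [G = 0]. *)
have [I0 _|I_neq0] := eqVneq I 0; last first.
  have I_gt0 : 0 < I by rewrite lt0r I_neq0.
  have I2_gt0 : 0 < I ^+ 2 by rewrite exprn_gt0.
  rewrite [leLHS](_ : _ = I ^+ 2 * ((h ^+ 2 + (h - 1) ^+ 2) * G ^+ 2)); last by ring.
  rewrite [leRHS](_ : _ = I ^+ 2 * ((h - 1) ^+ 2 * (sgnP * N))); last by ring.
  rewrite ler_pM2l// => /le_trans; apply; apply: ler_wpM2l; first exact: sqr_ge0.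
  exact: ler_piMl.
have vanish (w : Omega -> R) : (forall x, 0 <= w x) -> expect mu w = 0 ->
    forall x, mu x * w x `^ h = 0.
  move=> w_ge0 /eqP; rewrite psumr_eq0 => [/allP w0 x|x _]; last exact: mulr_ge0.
  have := w0 x (mem_index_enum _); rewrite /= mulf_eq0 => /orP[/eqP ->|/eqP ->].
    by rewrite mul0r.
  by rewrite powR0 ?mulr0// gt_eqF.
have -> : G = 0.
  apply: big1 => x _; rewrite /spow mulrBr.
  by rewrite (vanish u)// (vanish v)// ?subrr// -Euv.
by rewrite expr0n mulr0 mulr_ge0 ?sqr_ge0.
Qed.

End MeanZero.

(** * A one-sided Gronwall lemma *)

Section Gronwall.
Context {R : realType}.

(** Compare [F] with [B t], the expected bound relaxed by a slack [e * t]. The supremum [z] of the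
    times in [[0, T]] where [F <= B] is such a time by continuity, and if [z < T] the step
    hypothesis carries the bound past [z]. Finally the slack tends to 0. *)
Lemma gronwall_right (F : R -> R) (c T : R) :
  (forall t, 0 <= F t) ->
  (forall t : R, 0 <= t -> F s @[s --> within `[0, +oo[ (nbhs t)] --> F t) ->
  (forall t e : R, 0 <= t -> 0 < e ->
    \forall s \near 0^'+, F (t + s) <= (1 - c * s) * F t + e * s) ->
  0 <= T -> F T <= expR (- (c * T)) * F 0.
Proof.
move=> F_ge0 Fc Fstep T_ge0.
suff bound (e : R) : 0 < e -> F T <= expR (- (c * T)) * (F 0 + e * T).
  apply/ler_addgt0Pr => e e_gt0; pose d := e / (expR (- (c * T)) * (T + 1)).
  have d_gt0 : 0 < d by rewrite divr_gt0// mulr_gt0 ?expR_gt0//; lra.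
  apply: (le_trans (bound _ d_gt0)); rewrite mulrDr lerD2l.
  rewrite [leRHS](_ : _ = expR (- (c * T)) * (d * (T + 1))).
    by rewrite ler_pM2l ?expR_gt0// ler_pM2l//; lra.
  by rewrite /d; field; rewrite !gt_eqF ?expR_gt0//; lra.
move=> e_gt0; pose B t := expR (- (c * t)) * (F 0 + e * t).
pose A := [set t | 0 <= t <= T /\ F t <= B t].
have A0 : A 0 by split; rewrite ?lexx// /B mulr0 oppr0 expR0 mulr0 addr0 mul1r.
have ubA : ubound A T by move=> t [/andP[]].
have supA : has_sup A by split; [exists 0|exists T].
pose z := sup A.
have z_ge0 : 0 <= z by apply: ub_le_sup => //; exists T.
have z_leT : z <= T by apply: ge_sup => //; exists 0.
have Az : A z.
  split; first by rewrite z_ge0.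
  rewrite leNgt; apply/negP => BF.
  have Bc : {for z, continuous B}.
    apply: differentiable_continuous; apply/derivable1_diffP.
    by apply: ex_derive.
  have FBc : F s - B s @[s --> within `[0, +oo[ (nbhs z)] --> F z - B z.
    by apply: cvgB; [exact: Fc|apply: cvg_within_filter; exact: Bc].
  have FB_gt0 : 0 < F z - B z by rewrite subr_gt0.
  have : \forall s \near within `[0, +oo[ (nbhs z), 0 < F s - B s.
    by apply: (cvgr_gt _ FBc).
  rewrite near_withinE => /nbhs_ballP[d /= d_gt0 zd].
  have [a Aa za] := sup_adherent d_gt0 supA.
  have [/andP[a_ge0 _] aB] := Aa.
  have : 0 < F a - B a.
    apply: zd; last by rewrite /= in_itv/= a_ge0.
    have a_le : a <= z by apply: ub_le_sup => //; exists T.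
    by rewrite /ball/= ger0_norm ?subr_ge0//; move: za; rewrite -/z; lra.
  by rewrite subr_gt0 ltNge aB.
have [zT|zT] := ltP z T; last first.
  by have -> : T = z; [apply/le_anti; rewrite zT z_leT|case: Az].
(* [expR (- b)] is at most [expR (- (c * t))] on [[0, T]] whatever the sign of [c], so a step error
   of [e * expR (- b) * s] fits into the slack gained by [B]. *)
pose b := `|c| * T.
have m_gt0 : 0 < e * expR (- b) by rewrite mulr_gt0 ?expR_gt0.
have : \forall s \near 0^'+, A (z + s) /\ 0 < s.
  near=> s.
  have s_gt0 : 0 < s by [].
  have zsT : z + s <= T.
    rewrite -lerBrDl; near: s; apply: nbhs_right_le; rewrite subr_gt0//.
  split=> //; split; first by rewrite zsT andbT addr_ge0// ltW.
  have Fzs : F (z + s) <= (1 - c * s) * F z + e * expR (- b) * s.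
    by near: s; exact: Fstep.
  apply: (le_trans Fzs).
  apply: (@le_trans _ _ (expR (- (c * s)) * B z + e * expR (- (c * (z + s))) * s)).
    apply: lerD.
      apply: (@le_trans _ _ (expR (- (c * s)) * F z)).
        by apply: ler_wpM2r => //; have := expR_ge1Dx (- (c * s)).
      by apply: ler_wpM2l; [exact: expR_ge0|case: Az].
    apply: ler_wpM2r; first exact: ltW.
    apply: ler_wpM2l; first exact: ltW.
    rewrite ler_expR lerN2 /b; apply: (@le_trans _ _ (`|c| * (z + s))).
      by apply: ler_wpM2r; [rewrite addr_ge0// ltW|exact: ler_norm].
    exact: ler_wpM2l.
  rewrite /B (_ : - (c * (z + s)) = - (c * s) + - (c * z)); last by ring.
  by rewrite expRD le_eqVlt; apply/orP; left; apply/eqP; ring.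
move=> /filter_ex[s [Azs s_gt0]].
have : z + s <= z by apply: ub_le_sup => //; exists T.
by rewrite gerDl leNgt s_gt0.
Unshelve. all: by end_near.
Qed.

End Gronwall.

(** With theta = (p - 2)/p this is (1 - theta^2) / ((1 + theta^2) C). *)
Definition decay_rate {R : realType} (C p : R) : R :=
  (2 * p - 2) / ((p ^+ 2 - 2 * p + 2) * C).

(** * Convergence at atoms of positive mass *)

Section Semigroup.
Context {R : realType} {Omega : finType}.
Variable mu : Omega -> R.
Hypothesis mu_prob : is_probability mu.
Implicit Types (f g : Omega -> R).

Lemma sqr_normr_le_Lp_norm2 f x : mu x * `|f x| ^+ 2 <= Lp_norm mu 2 f ^+ 2.
Proof.
have [mu_ge0 _] := mu_prob.
have E_ge0 : 0 <= expect mu (fun x => `|f x| `^ 2).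
  by apply: expect_ge0 => // y; exact: powR_ge0.
rewrite /Lp_norm powR12_sqrt// sqr_sqrtr// /expect (bigD1 x)//= powR_mulrn//.
by rewrite lerDl sumr_ge0// => y _; rewrite mulr_ge0 ?powR_ge0.
Qed.

(** One atom bounds the norm from below, so an L^2 limit is a pointwise limit wherever the mass is
    positive. *)
Lemma Lp_norm2_cvg0 (T : Type) (Fl : set_system T) {FF : Filter Fl}
  (g : T -> Omega -> R) x : 0 < mu x ->
  Lp_norm mu 2 (g s) @[s --> Fl] --> 0 -> g s x @[s --> Fl] --> 0.
Proof.
move=> mux_gt0 /cvgrPdist_lt gc; apply/cvgrPdist_lt => e e_gt0.
have d_gt0 : 0 < e * Num.sqrt (mu x) by rewrite mulr_gt0 ?sqrtr_gt0.
apply: filterS (gc _ d_gt0) => s; rewrite !sub0r !normrN => gs.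
have := sqr_normr_le_Lp_norm2 (g s) x.
rewrite -(ltr_pM2r (_ : 0 < Num.sqrt (mu x))) ?sqrtr_gt0//.
move=> le2; apply: (le_lt_trans _ gs).
rewrite -ler_sqr ?nnegrE ?mulr_ge0 ?sqrtr_ge0// exprMn sqr_sqrtr ?(ltW mux_gt0)//.
by rewrite mulrC (ger0_norm (powR_ge0 _ _)).
Qed.

(** * Symmetric Markov operators and their Dirichlet forms *)

Section Operator.
Variable T : (Omega -> R) -> Omega -> R.
Hypothesis T_linear : L2_linear mu T.

Lemma L2_linear_sum (s : seq Omega) (a : Omega -> R) (e : Omega -> Omega -> R) :
  as_eq mu (T (fun x => \sum_(y <- s) a y * e y x))
           (fun x => \sum_(y <- s) a y * T (e y) x).
Proof.
elim: s => [|y s IH] x mux_gt0.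
  under eq_fun do rewrite big_nil.
  (* Linearity at [-1] and two zero functions shows that [T] sends 0 to 0 almost surely. *)
  have := L2_linearP T_linear (-1) (fun=> 0) (fun=> 0) mux_gt0.
  rewrite (_ : (fun=> -1 * 0 + 0) = fun=> 0); last by rewrite mulr0 addr0.
  by rewrite mulN1r addNr big_nil.
under eq_fun do rewrite big_cons.
by rewrite (L2_linearP T_linear (a y) (e y))// big_cons IH.
Qed.

Hypothesis T_nonneg : forall f, as_nonneg mu f -> as_nonneg mu (T f).
Hypothesis T_unit : as_eq mu (T (fun=> 1)) (fun=> 1).
Hypothesis T_selfadjoint : forall f g,
  expect mu (fun x => f x * T g x) = expect mu (fun x => T f x * g x).

Let point y : Omega -> R := fun z => (z == y)%:R.

Let pointE g : g = (fun z => \sum_y g y * point y z).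
Proof.
apply: funext => z; rewrite (bigD1 z)//= /point eqxx mulr1 big1 ?addr0// => y yz.
by rewrite eq_sym (negbTE yz) mulr0.
Qed.

(** Take [w x y = mu x * T (point y) x]: positivity of [T] gives the sign, self-adjointness on
    indicators of points the symmetry, and [T_unit] the row sums. The factor [mu x] hides the
    arbitrary values of [T] at null atoms. *)
Lemma symmetric_kernel : exists w : Omega -> Omega -> R,
  [/\ forall x y, 0 <= w x y, forall x y, w x y = w y x,
      forall x, \sum_y w x y = mu x &
      forall f g, expect mu (fun x => f x * T g x)
                  = \sum_x \sum_y w x y * (f x * g y)].
Proof.
have [mu_ge0 _] := mu_prob.
pose w x y := mu x * T (point y) x.
have kernel g x : mu x * T g x = \sum_y w x y * g y.
  have := mu_ge0 x; rewrite le_eqVlt => /predU1P[mux0|mux_gt0].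
    by rewrite -mux0 mul0r big1// => y _; rewrite /w -mux0 !mul0r.
  rewrite {1}[g]pointE L2_linear_sum// mulr_sumr.
  by apply: eq_bigr => y _; rewrite /w mulrCA mulrC.
exists w; split.
- move=> x y; have := mu_ge0 x; rewrite le_eqVlt => /predU1P[mux0|mux_gt0].
    by rewrite /w -mux0 mul0r.
  by rewrite mulr_ge0//; apply: T_nonneg => // z _; exact: ler0n.
- have expect_point y g : expect mu (fun x => point y x * g x) = mu y * g y.
    rewrite /expect (bigD1 y)//= /point eqxx mul1r big1 ?addr0// => z zy.
    by rewrite (negbTE zy) mul0r mulr0.
  move=> x y; rewrite /w -expect_point T_selfadjoint.
  by under eq_fun do rewrite mulrC; rewrite expect_point.
- move=> x; under eq_bigr do rewrite -[w _ _]mulr1.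
  rewrite -kernel; have := mu_ge0 x.
  by rewrite le_eqVlt => /predU1P[<-|/T_unit ->]; rewrite ?mul0r ?mulr1.
- move=> f g; rewrite /expect; apply: eq_bigr => x _.
  rewrite mulrCA kernel mulr_sumr; apply: eq_bigr => y _.
  by rewrite mulrCA.
Qed.

(** Symmetrizing with the kernel, E[a (b - T b)] is half the sum of w(x,y) (a(x) - a(y)) (b(x) -
    b(y)), so the pointwise comparison can be summed with nonnegative weights. *)
Lemma expect_id_sub_le (k H : R) (f phi psi : Omega -> R) :
  (forall x y, k * (psi x - psi y) ^+ 2
               <= H * ((f x - f y) * (phi x - phi y))) ->
  k * expect mu (fun x => psi x * (psi x - T psi x))
    <= H * expect mu (fun x => phi x * (f x - T f x)).
Proof.
move=> cmp; have [w [w_ge0 wC w1 wE]] := symmetric_kernel.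
have dirichlet a b : expect mu (fun x => a x * (b x - T b x))
    = 2^-1 * \sum_x \sum_y w x y * ((b x - b y) * (a x - a y)).
  transitivity (\sum_x \sum_y w x y * (a x * (b x - b y))).
    transitivity (expect mu (fun x => a x * b x) - expect mu (fun x => a x * T b x)).
      by rewrite /expect -sumrB; apply: eq_bigr => x _; rewrite -!mulrBr.
    rewrite wE /expect -sumrB; apply: eq_bigr => x _.
    rewrite -w1 mulr_suml -sumrB; apply: eq_bigr => y _; ring.
  set S := \sum_x \sum_y _.
  have swap : S = \sum_x \sum_y w x y * (a y * (b y - b x)).
    by rewrite /S exchange_big; apply: eq_bigr => x _; apply: eq_bigr => y _; rewrite wC.
  rewrite -[LHS](mulKf (_ : 2 != 0 :> R)) ?pnatr_eq0//; congr (_ * _).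
  rewrite mulr_natl mulr2n {2}swap /S -big_split/=; apply: eq_bigr => x _.
  by rewrite -big_split; apply: eq_bigr => y _; rewrite /=; ring.
rewrite !dirichlet !(mulrCA _ 2^-1) ler_pM2l ?invr_gt0// !mulr_sumr.
apply: ler_sum => x _; rewrite !mulr_sumr; apply: ler_sum => y _.
by rewrite !(mulrCA _ (w x y)) ler_wpM2l// -expr2.
Qed.

End Operator.

(** * The generator as a limit of difference quotients *)

Variables (P : R -> (Omega -> R) -> Omega -> R) (L : (Omega -> R) -> Omega -> R).
Hypothesis P_semigroup : symmetric_Markov_semigroup mu P.
Hypothesis L_generator : is_generator mu P L.

Lemma expect_semigroup f (t : R) : 0 <= t -> expect mu (P t f) = expect mu f.
Proof.
move=> t_ge0; have := semigroup_selfadjoint P_semigroup (fun=> 1) f t_ge0.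
under eq_fun do rewrite mul1r.
move=> ->; apply: eq_expect => // x mux_gt0.
by rewrite (semigroup_unit P_semigroup)// mul1r.
Qed.

Lemma semigroup_cvg f (t : R) x : 0 <= t -> 0 < mu x ->
  P s f x @[s --> within `[0, +oo[ (nbhs t)] --> P t f x.
Proof.
move=> t_ge0 mux_gt0; apply/subr_cvg0.
apply: (Lp_norm2_cvg0 (g := fun s x => P s f x - P t f x)) => //.
exact: semigroup_continuous.
Qed.

Lemma generator_cvg f x : 0 < mu x ->
  s^-1 * (f x - P s f x) @[s --> 0^'+] --> L f x.
Proof.
move=> mux_gt0; have P0 := semigroup0 P_semigroup f mux_gt0.
have : s^-1 * (P s f x - P 0 f x) - - L f x @[s --> 0^'+] --> 0.
  apply: (Lp_norm2_cvg0
    (g := fun s x => s^-1 * (P s f x - P 0 f x) - - L f x)) => //.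
move=> /subr_cvg0/cvgN; rewrite opprK; apply: cvg_trans.
by apply: near_eq_cvg; apply: nearW => s /=; rewrite P0 -mulrN opprB.
Qed.

Lemma expect_cvg (T : Type) (Fl : set_system T) {FF : Filter Fl}
  (g : T -> Omega -> R) (l : Omega -> R) :
  (forall x, 0 < mu x -> g s x @[s --> Fl] --> l x) ->
  expect mu (g s) @[s --> Fl] --> expect mu l.
Proof.
move=> gl; apply: cvg_big => [|x _]; first exact: add_continuous.
have : 0 <= mu x by case: mu_prob.
rewrite le_eqVlt => /predU1P[<-|mux_gt0].
  by under eq_fun do rewrite mul0r; rewrite mul0r; exact: cvg_cst.
by apply: cvgM; [exact: cvg_cst|exact: gl].
Qed.

(** The comparison holds for each [P s] by [expect_id_sub_le]; divide by [s] and let [s] decrease to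
    0. *)
Lemma expect_generator_le (k H : R) (f phi psi : Omega -> R) :
  (forall x y, k * (psi x - psi y) ^+ 2
               <= H * ((f x - f y) * (phi x - phi y))) ->
  k * expect mu (fun x => psi x * L psi x)
    <= H * expect mu (fun x => phi x * L f x).
Proof.
move=> cmp.
have lim a b (m : R) : m * expect mu (fun x => a x * (s^-1 * (b x - P s b x)))
    @[s --> 0^'+] --> m * expect mu (fun x => a x * L b x).
  apply: cvgM; first exact: cvg_cst.
  apply: expect_cvg => x mux_gt0.
  by apply: cvgM; [exact: cvg_cst|exact: generator_cvg].
apply: (ler_cvg_to (lim psi psi k) (lim phi f H)).
near=> s; have s_gt0 : 0 < s by [].
have s_ge0 := ltW s_gt0.
have pull a b : expect mu (fun x => a x * (s^-1 * (b x - P s b x)))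
    = s^-1 * expect mu (fun x => a x * (b x - P s b x)).
  by rewrite -expectZ; apply: eq_bigr => x _; rewrite (mulrCA (a x)).
rewrite !pull !(mulrCA _ s^-1) ler_pM2l ?invr_gt0//.
apply: expect_id_sub_le => //.
- exact: semigroup_linear P_semigroup _ s_ge0.
- by move=> g; exact: semigroup_nonneg P_semigroup _ _ s_ge0.
- exact: semigroup_unit P_semigroup _ s_ge0.
- by move=> a b; exact: semigroup_selfadjoint P_semigroup _ _ _ s_ge0.
Unshelve. all: by end_near.
Qed.

(** * Decay of E|P_t f|^p under the Poincare inequality *)

Variable C : R.
Hypothesis C_gt0 : 0 < C.
Hypothesis poincare : forall f : Omega -> R,
  expect mu (fun x => f x ^+ 2) - expect mu f ^+ 2
    <= C * expect mu (fun x => f x * L f x).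

(** With K = h^2 + (h-1)^2, the mean-zero bound, Poincare for [g] and Stroock-Varopoulos give in
    turn (2h-1) h^2 N <= (2h-1) K (N - G^2) <= (2h-1) K C Q <= K C h^2 D. *)
Lemma expect_spow_generator_ge (p : R) f : 1 < p -> expect mu f = 0 ->
  decay_rate C p * expect mu (fun x => `|f x| `^ p)
    <= expect mu (fun x => spow (p - 1) (f x) * L f x).
Proof.
move=> p_gt1 Ef0; pose h := p / 2.
have ph : p = 2 * h by rewrite /h; field.
have h_gt : 2^-1 < h by rewrite /h; lra.
have h_gt0 : 0 < h by lra.
rewrite /decay_rate ph.
set N := expect mu _; set D := expect mu (fun x => spow _ _ * _).
pose g x := spow h (f x).
have SV : (2 * h - 1) * expect mu (fun x => g x * L g x) <= h ^+ 2 * D.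
  by apply: expect_generator_le => x y; exact: spow_StroockVaropoulos.
have Eg2 : expect mu (fun x => g x ^+ 2) = N.
  by apply: eq_bigr => x _; rewrite sqr_spow.
have mean := sqr_expect_spow_le mu_prob h_gt Ef0.
have := poincare g; rewrite Eg2.
set G := expect mu g; set Q := expect mu (fun x => g x * L g x) => PQ.
have K_gt0 : 0 < h ^+ 2 + (h - 1) ^+ 2 by rewrite ltr_wpDr ?sqr_ge0 ?exprn_gt0.
have h2N : h ^+ 2 * N <= (h ^+ 2 + (h - 1) ^+ 2) * (N - G ^+ 2).
  by move: mean; rewrite -/N -/G; lra.
have q_gt0 : 0 < 2 * h - 1 by lra.
rewrite (_ : _ / _ = (2 * h - 1) / ((h ^+ 2 + (h - 1) ^+ 2) * C)); last first.
  rewrite (_ : (2 * h) ^+ 2 - 2 * (2 * h) + 2 = 2 * (h ^+ 2 + (h - 1) ^+ 2));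
    last by ring.
  by field; rewrite !gt_eqF.
rewrite mulrAC ler_pdivrMr ?mulr_gt0// -(@ler_pM2l _ (h ^+ 2)) ?exprn_gt0//.
rewrite mulrCA.
apply: (le_trans (ler_wpM2l (ltW q_gt0) h2N)).
apply: (@le_trans _ _ ((h ^+ 2 + (h - 1) ^+ 2) * C * ((2 * h - 1) * Q))).
  rewrite [leRHS](_ : _ = (2 * h - 1) * ((h ^+ 2 + (h - 1) ^+ 2) * (C * Q)));
    last by ring.
  by rewrite !ler_pM2l.
rewrite [leRHS](_ : _ = (h ^+ 2 + (h - 1) ^+ 2) * C * (h ^+ 2 * D)); last by ring.
by rewrite ler_pM2l ?mulr_gt0.
Qed.

(** The tangent is taken at [P s f] and not at [f], which yields the upper bound E|P_s f|^p <= N - p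
    s Q(s). As [s] decreases to 0, [Q s] tends to the quantity bounded in
    [expect_spow_generator_ge]. *)
Lemma expect_powR_step (p : R) f (e : R) : 1 < p -> expect mu f = 0 -> 0 < e ->
  \forall s \near 0^'+, expect mu (fun x => `|P s f x| `^ p)
    <= (1 - p * decay_rate C p * s) * expect mu (fun x => `|f x| `^ p) + e * s.
Proof.
move=> p_gt1 Ef0 e_gt0; have p_gt0 : 0 < p by lra.
have P0 x : 0 < mu x -> P s f x @[s --> 0^'+] --> f x.
  move=> mux_gt0; rewrite -[f x](semigroup0 P_semigroup f mux_gt0).
  apply: (cvg_trans _ (semigroup_cvg (t := 0) (f := f) (lexx 0) mux_gt0)).
  apply: cvg_app; apply: within_subset => s s_gt0.
  by rewrite /= in_itv/= andbT ltW.
set N := expect mu (fun x => `|f x| `^ p).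
pose Q s := expect mu (fun x => spow (p - 1) (P s f x) * (s^-1 * (f x - P s f x))).
have Q_cvg : Q s @[s --> 0^'+] --> expect mu (fun x => spow (p - 1) (f x) * L f x).
  apply: expect_cvg => x mux_gt0; apply: cvgM; last exact: generator_cvg.
  apply: (cvg_comp _ _ (P0 x mux_gt0)); apply: continuous_spow; lra.
(* The loss [e / p], multiplied by [p * s], is the permitted error [e * s]. *)
have Q_gt : decay_rate C p * N - e / p < expect mu (fun x => spow (p - 1) (f x) * L f x).
  apply: lt_le_trans (expect_spow_generator_ge p_gt1 Ef0).
  by rewrite ltrBlDr ltrDl divr_gt0.
near=> s; have s_gt0 : 0 < s by [].
have QsN : decay_rate C p * N - e / p < Q s by near: s; exact: (cvgr_gt _ Q_cvg).
have step : expect mu (fun x => `|P s f x| `^ p) + p * s * Q s <= N.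
  rewrite /Q -expectZ -expectD; apply: ler_expect => // x.
  apply: le_trans (powR_tangent_le (f x) (P s f x) p_gt1).
  by rewrite lerD2l le_eqVlt; apply/orP; left; apply/eqP; field; rewrite gt_eqF.
have : p * s * (decay_rate C p * N - e / p) <= p * s * Q s.
  by rewrite ler_pM2l ?mulr_gt0// ltW.
rewrite (_ : p * s * (_ - _) = p * decay_rate C p * s * N - e * s); last first.
  by field; rewrite gt_eqF.
by move: step; lra.
Unshelve. all: by end_near.
Qed.

Lemma expect_powR_semigroup_le (p : R) f (t : R) :
  1 < p -> expect mu f = 0 -> 0 <= t ->
  expect mu (fun x => `|P t f x| `^ p)
    <= expR (- (p * decay_rate C p * t)) * expect mu (fun x => `|f x| `^ p).
Proof.
move=> p_gt1 Ef0 t_ge0.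
pose F s := expect mu (fun x => `|P s f x| `^ p).
have -> : expect mu (fun x => `|f x| `^ p) = F 0.
  by apply: eq_expect => // x mux_gt0; rewrite (semigroup0 P_semigroup).
apply: (@gronwall_right R F) => //.
- by move=> s; apply: expect_ge0 => // x; exact: powR_ge0.
- move=> s s_ge0; apply: (expect_cvg (g := fun r x => `|P r f x| `^ p)) => x mux_gt0.
  apply: (@cvg_comp _ _ _ _ (fun y : R => `|y| `^ p) _ _ _
    (semigroup_cvg (f := f) s_ge0 mux_gt0)).
  by apply: (continuous_normr_powR (a := p)); lra.
- move=> s e s_ge0 e_gt0.
  (* The mean stays zero, so the step at time 0 can be repeated from [P s f]. *)
  have EPf : expect mu (P s f) = 0 by rewrite expect_semigroup.
  near=> r; have r_gt0 : 0 < r by [].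
  have -> : F (s + r) = expect mu (fun x => `|P r (P s f) x| `^ p).
    apply: eq_expect => // x mux_gt0.
    by rewrite addrC (semigroupD P_semigroup)// ltW.
  by near: r; exact: expect_powR_step.
Unshelve. all: by end_near.
Qed.

End Semigroup.

Theorem theorem1p17 (R : realType) (Omega : finType) (mu : Omega -> R)
  (P : R -> (Omega -> R) -> Omega -> R) (L : (Omega -> R) -> Omega -> R)
  (C : R)
  (mu_prob : is_probability mu)
  (P_semigroup : symmetric_Markov_semigroup mu P)
  (L_generator : is_generator mu P L)
  (C_gt0 : 0 < C)
  (poincare : forall f : Omega -> R,
    expect mu (fun x => f x ^+ 2) - expect mu f ^+ 2
      <= C * expect mu (fun x => f x * L f x)) :
  forall (p : R) (f : Omega -> R) (t : R),
    1 < p -> expect mu f = 0 -> 0 < t ->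
    Lp_norm mu p (P t f)
      <= expR (- (((2 * p - 2) * t) / ((p ^+ 2 - 2 * p + 2) * C)))
         * Lp_norm mu p f.
Proof.
move=> p f t p_gt1 Ef0 t_gt0; have p_gt0 : 0 < p by lra.
have Ep_ge0 g : 0 <= expect mu (fun x => `|g x| `^ p).
  by apply: expect_ge0 => // x; exact: powR_ge0.
have := expect_powR_semigroup_le mu_prob P_semigroup L_generator C_gt0 poincare
  p_gt1 Ef0 (ltW t_gt0).
(* Taking p-th roots divides the exponent by [p]. *)
move=> /(ge0_ler_powR (_ : 0 <= p^-1)); rewrite invr_ge0 (ltW p_gt0) !nnegrE.
rewrite mulr_ge0 ?expR_ge0 ?Ep_ge0// => /(_ isT isT isT).
rewrite powRM ?expR_ge0 ?Ep_ge0// -expRM mulNr.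
rewrite (_ : p * decay_rate C p * t / p
           = (2 * p - 2) * t / ((p ^+ 2 - 2 * p + 2) * C))//.
have p2_gt0 : 0 < p ^+ 2 - 2 * p + 2 by have := sqr_ge0 (p - 1); lra.
by rewrite /decay_rate; field; rewrite !gt_eqF.
Qed.
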